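(* Let $\beta=\frac{1+\sqrt5}2$, let $x=x_1\cdots x_n\in\{-1,0,1\}^*$ and $z=\sum_{j=1}^n x_j\beta^{-j}$. For $1\le j\le n$ put $t_j=\beta^{j-1}z-\sum_{i=1}^{j-1}x_i\beta^{j-1-i}$. Then $x$ is a $\beta$-expansion of minimal weight if and only if $-\frac{2\beta}{\beta^2+1}<z<\frac{2\beta}{\beta^2+1}$ and for every $j$, $1\le j\le n$, one of the following holds: (i) $\frac2{\beta^2+1}<t_j<\frac{2\beta}{\beta^2+1}$ and $x_j=1$; (ii) $\frac\beta{\beta^2+1}<t_j<\frac2{\beta^2+1}$ and $x_j\in\{0,1\}$; (iii) $\frac{-\beta}{\beta^2+1}<t_j<\frac\beta{\beta^2+1}$ and $x_j=0$; (iv) $\frac{-2}{\beta^2+1}<t_j<\frac{-\beta}{\beta^2+1}$ and $x_j\in\{-1,0\}$; (v) $\frac{-2\beta}{\beta^2+1}<t_j<\frac{-2}{\beta^2+1}$ and $x_j=-1$.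
   Context: For a finite word $x=x_1\cdots x_n$ over $\mathbb Z$, write $.x=\sum_{j=1}^n x_j\beta^{-j}$ and $\|x\|=\sum_{j=1}^n|x_j|$. For $x,y\in\mathbb Z^*$, $x\sim_\beta y$ means $.x=\beta^k\cdot .y$ for some $k\in\mathbb Z$. A word $x$ is $\beta$-heavy if there is $y\in\mathbb Z^*$ with $x\sim_\beta y$ and $\|y\|<\|x\|$; otherwise $x$ is a $\beta$-expansion of minimal weight. *)

(* Defs.v *)
From mathcomp Require Import all_boot all_order all_algebra.
From mathcomp Require Import reals.

Set Implicit Arguments.
Unset Strict Implicit.
Unset Printing Implicit Defensive.

Import Order.TTheory GRing.Theory Num.Theory.
Local Open Scope ring_scope.

(* Finite words over Z are sequences x : seq int of length n = size x.
   Sequences are 0-based, so the 1-based letter x_j is x`_(j.-1). *)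
Definition letter (x : seq int) (j : nat) : int := x`_j.-1.

(* .x = \sum_(j = 1..n) x_j beta^(-j) *)
Definition word_value (R : realType) (beta : R) (x : seq int) : R :=
  \sum_(1 <= j < (size x).+1) (letter x j)%:~R * beta ^- j.

Definition weight (x : seq int) : nat :=
  (\sum_(1 <= j < (size x).+1) absz (letter x j))%N.

(* The exponent k ranges over Z: _ ^ _ is the integer power. *)
Definition beta_equiv (R : realType) (beta : R) (x y : seq int) : Prop :=
  exists k : int, word_value beta x = beta ^ k * word_value beta y.

Definition beta_heavy (R : realType) (beta : R) (x : seq int) : Prop :=
  exists y : seq int, beta_equiv beta x y /\ (weight y < weight x)%N.

Definition minimal_weight (R : realType) (beta : R) (x : seq int) : Prop :=
  ~ beta_heavy beta x.

Definition golden_ratio (R : realType) : R := (1 + Num.sqrt 5) / 2.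

(* t_j = beta^(j-1) z - \sum_(i = 1..j-1) x_i beta^(j-1-i); it is used for
   j >= 1 only, where the subtractions on exponents are exact. *)
Definition remainder (R : realType) (beta : R) (x : seq int) (z : R)
    (j : nat) : R :=
  beta ^+ (j - 1) * z
  - \sum_(1 <= i < j) (letter x i)%:~R * beta ^+ (j - 1 - i).

(* Main.v *)
(* Multiply all values by b^2 + 1 = b + 2, so that the thresholds become -2b, -2,
   -b, b, 2, 2b; no word value equals 2, -2, b or -b, because values are
   multiples of b + 2, an element of norm 5.  Call a word good if it obeys the
   digit rules.
   (1) Good words of equal value have equal weight: where two digits are allowed,
       the identity 1 0 0 -1 = 0 1 0 0 1 converts one choice into the other.
   (2) Adding b^(-m) to the value of a good word costs at most 1, as long as
       the sum stays in range.  For m >= 5 both words can share their first digit,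
       which reduces m; small m are local rewritings.
   By (2) every integer word is matched, up to a power of b, by a good word of no
   larger weight, and with (1) good words are minimal.  Conversely, prefixing a
   good word by a forbidden digit creates, after applying (1), one of 1 1 = 1 0 0,
   1 -1 = 0 0 1 or 1 0 -1 = 0 1 0, which is heavy. *)
Require Import Defs.
From mathcomp Require Import all_boot all_order all_algebra.
From mathcomp Require Import reals.
From mathcomp Require Import ring lra zify.

Import Order.TTheory GRing.Theory Num.Theory.
Local Open Scope ring_scope.

#[local] Set Default Proof Using "All".

(** * Golden ratio arithmetic, good words and the ideal of their values *)

Section Golden.
Variables (R : realFieldType) (b : R).
Hypotheses (b_gt0 : 0 < b) (bb : b * b = b + 1).

(** A failing bound, multiplied by [b], contradicts [bb]. The Fibonacci quotients 8/5 and 13/8 are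
    sharp enough for the numerical comparisons below. *)
Lemma b_bounds : 8 / 5 < b < 13 / 8.
Proof.
have key (c : R) : (c <= b -> c * b <= b * b) /\ (b <= c -> b * b <= c * b).
  by split=> h; rewrite ler_pM2r.
apply/andP; split; rewrite ltNge; apply/negP.
  by case: (key (8 / 5)) => _ h hc; have ? := h hc; have ? := bb; lra.
by case: (key (13 / 8)) => h _ hc; have ? := h hc; have ? := bb; lra.
Qed.

Lemma scale_lt (u v : R) : (u < v) -> b * u < b * v.
Proof. by rewrite ltr_pM2l. Qed.

Lemma bbM (t : R) : b * (b * t) = b * t + t.
Proof. by rewrite mulrA bb mulrDl mul1r. Qed.

(* t is (b + 2) times the value of a good word of length n and weight w. *)
Fixpoint rep_len (n : nat) (t : R) (w : nat) : Prop :=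
  if n is k.+1 then
    [\/ -2 < t < 2 /\ rep_len k (b * t) w,
        b < t < 2 * b /\ exists2 v, w = v.+1 & rep_len k (b * t - (b + 2)) v |
        - 2 * b < t < - b /\ exists2 v, w = v.+1 & rep_len k (b * t + (b + 2)) v]
  else t = 0 /\ w = 0%N.

Definition rep t w := exists n, rep_len n t w.

Lemma rep_len_opp n t w : rep_len n t w -> rep_len n (- t) w.
Proof.
elim: n t w => [|n IH] t w /=; first by case=> -> ->; rewrite oppr0.
case=> [[tb /IH]|[tb [v ->] /IH]|[tb [v ->] /IH]] h.
- by apply: Or31; split; [lra | rewrite mulrN].
- apply: Or33; split; first by lra.
  exists v => //; suff -> : b * - t + (b + 2) = - (b * t - (b + 2)) by []. ring.
- apply: Or32; split; first by lra.
  exists v => //; suff -> : b * - t - (b + 2) = - (b * t + (b + 2)) by []. ring.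
Qed.

Lemma rep_opp t w : rep t w -> rep (- t) w.
Proof. by case=> n /rep_len_opp; exists n. Qed.

Definition in_ideal (t : R) := exists p q : int, t = (p%:~R + q%:~R * b) * (b + 2).

Lemma rep_len_ideal n t w : rep_len n t w -> in_ideal t.
Proof.
have key t' e : in_ideal (b * t' - e%:~R * (b + 2)) -> in_ideal t'.
  (* Since [b] is a unit with inverse [b - 1], these are the coordinates of
     [(b - 1) * (p + e + q * b)]. *)
  case=> p [q h]; exists (q - p - e), (p + e).
  have -> : t' = (b - 1) * (b * t').
    by rewrite mulrBl bbM; lra.
  have -> : b * t' = ((p + e)%:~R + q%:~R * b) * (b + 2).
    by rewrite rmorphD /=; lra.
  rewrite !rmorphD !rmorphN /=; set x := p%:~R; set y := q%:~R; set z := e%:~R.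
  have -> : (b - 1) * ((x + z + y * b) * (b + 2)) = (b * (x + z) + (b * b) * y - x - z - y * b) * (b + 2) by ring.
  rewrite bb; ring.
elim: n t w => [|n IH] t w /=.
  by case=> -> _; exists 0, 0; rewrite mul0r addr0 mul0r.
case=> [[_ /IH]|[_ [v _] /IH]|[_ [v _] /IH]] h.
- by apply: (key _ 0); rewrite mul0r subr0.
- by apply: (key _ 1); rewrite mul1r.
- by apply: (key _ (-1)); rewrite mulN1r opprK.
Qed.

(* The norm of (c + d b) (b + 2) is divisible by 5; modulo 5 the norm form is,
   up to a unit, the square of 2 c + d. *)
Lemma in_ideal_neq t (c d : int) : in_ideal t -> ~~ (5 %| 2 * c + d)%Z -> t <> c%:~R + d%:~R * b.
Proof.
move=> [p [q ->]] h e.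
pose P := 2 * p + q - c; pose Q := p + 3 * q - d.
have e1 : P%:~R + Q%:~R * b = 0.
  rewrite /P /Q !rmorphD !rmorphN /= !rmorphM /=.
  move: e; set x := p%:~R; set y := q%:~R; set z := c%:~R; set u := d%:~R => e.
  have : (x + y * b) * (b + 2) = 2 * x + y + (x + 3 * y) * b.
    have -> : (x + y * b) * (b + 2) = x * b + y * (b * b) + 2 * x + 2 * y * b by ring.
    by rewrite bb; ring.
  by rewrite e => e'; lra.
(* The norm form of [P + Q * b]; four times it is [(2 * P + Q)^2 - 5 * Q^2]. *)
have e2 : (P * P + P * Q - Q * Q)%:~R = 0 :> R.
  rewrite !rmorphD !rmorphN /= !rmorphM /=.
  move: e1; set x := P%:~R; set y := Q%:~R => e1.
  have -> : x = - (y * b) by lra.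
  have -> : - (y * b) * - (y * b) + - (y * b) * y - y * y = y * y * (b * b - b - 1) by ring.
  by rewrite bb; ring.
move/eqP: e2; rewrite intr_eq0 => /eqP e2.
have e3 : (2 * P + Q) * (2 * P + Q) = 5 * (Q * Q) by lia.
have e4 : 2 * P + Q = 5 * (p + q) - (2 * c + d) by rewrite /P /Q; lia.
move: h e3; rewrite e4; move: (2 * c + d) (p + q) (Q * Q) => r s m.
move=> h e3; move/negP: h; apply.
have : (5 %| r * r)%Z.
  by apply/dvdzP; exists (m - 5 * s * s + 2 * s * r); lia.
by rewrite !dvdzE abszM /= Euclid_dvdM // orbb.
Qed.

Ltac split_hyps := repeat match goal with
  H : is_true (_ && _) |- _ => let H1 := fresh in let H2 := fresh in case/andP: H => H1 H2 end.
Ltac scale_hyps := repeat match goal with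
  H : is_true (@Order.lt _ _ ?u ?v) |- _ =>
    tryif constr_eq H b_gt0 then fail else idtac;
    let H1 := fresh in let H2 := fresh in
    have H1 := scale_lt _ _ H; have H2 := scale_lt _ _ H1;
    move: H H1 H2 end.
Lemma b3 : b * b * b = 2 * b + 1.
Proof. have ? := bb; rewrite bb mulrDl mul1r; lra. Qed.

Lemma b4 : b * b * b * b = 3 * b + 2.
Proof. have ? := bb; rewrite b3 mulrDl mul1r -mulrA bb; lra. Qed.

Lemma bbM3 t : b * (b * (b * t)) = 2 * (b * t) + t.
Proof. by rewrite !bbM; ring. Qed.

Lemma bbM4 t : b * (b * (b * (b * t))) = 3 * (b * t) + 2 * t.
Proof. by rewrite !bbM; ring. Qed.

(** [lra] never multiplies by [b]. So each strict bound is also supplied times [b] and [b * b], and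
    nested products are reduced to combinations of [b * t] and [t]. *)
Ltac scaled_lra t :=
  have ? := b3; have ? := bbM t; have ? := bbM3 t;
  split_hyps; scale_hyps; intros;
  have ? := b_bounds; have ? := bb; lra.

Ltac eqb t :=
  have ? := b3; have ? := b4; have ? := bbM t; have ? := bbM3 t; have ? := bbM4 t;
  have ? := bb; lra.

Lemma rep_mk0 t v w : rep v w -> v = b * t -> -2 < t < 2 -> rep t w.
Proof. by case=> n h e tb; exists n.+1; apply: Or31; rewrite -e. Qed.

Lemma rep_mk1 t v w : rep v w -> v = b * t - (b + 2) -> b < t < 2 * b -> rep t w.+1.
Proof. by case=> n h e tb; exists n.+1; apply: Or32; rewrite -e; split=> //; exists w. Qed.

Lemma rep_mkN1 t v w : rep v w -> v = b * t + (b + 2) -> - 2 * b < t < - b -> rep t w.+1.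
Proof. by case=> n h e tb; exists n.+1; apply: Or33; rewrite -e; split=> //; exists w. Qed.

Lemma rep_len_digit0 n t w : rep_len n.+1 t w -> - b < t < b -> rep_len n (b * t) w.
Proof. case=> [[]//|[h _]|[h _]]; lra. Qed.

Lemma rep_len_digit1 n t w : rep_len n.+1 t w -> 2 < t ->
  exists2 v, w = v.+1 & rep_len n (b * t - (b + 2)) v.
Proof. case=> [[]//|[]//|[h _]] ?; have ? := b_bounds; lra. Qed.

(** * Exchanging the two digits allowed in an overlap *)

(** Adding a unit for free. When 1 0 0 y has its value [t] in the overlap (b, 2), y lies exactly in
    (-(b+1), -1); the exchange 1 0 0 y = 0 1 0 (y + 1) therefore asks for this claim. *)
Definition near_add n := forall t w, rep_len n t w -> - (b + 1) < t < -1 -> rep (t + (b + 2)) w.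

Lemma near_sub n t w : near_add n -> rep_len n t w -> 1 < t < b + 1 -> rep (t - (b + 2)) w.
Proof.
move=> h /rep_len_opp /h {}h tb; have /h/rep_opp : - (b + 1) < - t < -1 by lra.
by rewrite opprD opprK.
Qed.

(** Only a leading 0 needs work: then [t < 2], the next digits are forced to be 1 0, and 0 1 0 y = 1
    0 0 (y - 1). The tail y is three digits shorter, within reach of the hypothesis. *)
Lemma switch_01 n t w : (forall m, (m < n)%N -> near_add m) -> rep_len n t w ->
  b < t < 2 * b -> exists2 v, w = v.+1 & rep (b * t - (b + 2)) v.
Proof.
move=> IH; case: n IH => [|n] IH; first by move=> [-> _] ?; have ? := b_bounds; lra.
case=> [[t2 h]|[_ [v -> h]] _|[]]; last first.
- by move=> ? _ ?; have ? := b_bounds; lra.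
- by exists v => //; exists n.
move=> tb; case: n IH h => [|n] IH h; first by exfalso; case: h => ? _; scaled_lra t.
case: (rep_len_digit1 _ _ _ h) => [|v -> {}h]; first by scaled_lra t.
exists v => //; case: n IH h => [|n] IH h; first by exfalso; case: h => ? _; scaled_lra t.
have {}h : rep_len n (b * (b * (b * t) - (b + 2))) v by apply: rep_len_digit0 h _; scaled_lra t.
have {}h : rep (b * (b * (b * t) - (b + 2)) - (b + 2)) v.
  by apply: near_sub h _; [apply: IH; lia | scaled_lra t].
apply: rep_mk0 (erefl _) _; last by scaled_lra t.
apply: rep_mk0 h _ _; [eqb t | scaled_lra t].
Qed.

(** Strong induction on the length, with a point after the added unit: 1.0(-1)y = 0.10y, 1.(-1)0y =
    0.01y for [t < -2], and 1.(-1)00y = 0.100(y - 1) for [t > -2]. The first case calls the digit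
    exchange on a shorter word, the last one the claim itself. *)
Lemma near_addP n : near_add n.
Proof.
elim/ltn_ind: n => n IH t w h tb.
have switch m u x : (m < n)%N -> rep_len m u x -> - 2 * b < u < - b ->
    exists2 v, x = v.+1 & rep (b * u + (b + 2)) v.
  move=> mn /rep_len_opp hu ub.
  case: (switch_01 _ _ _ _ hu) => [k km|| v -> /rep_opp e].
  - by apply: IH; apply: ltn_trans km mn.
  - by lra.
  - by exists v => //; move: e; congr (rep _ _); ring.
have Mt := rep_len_ideal _ _ _ h.
case: n IH h switch => [|n] IH h switch; first by exfalso; case: h => ? _; lra.
case: h => [[t2 h]|[? _]|[t2 [v -> h]]]; last first.
- have [tm|tm|te] := ltgtP t (-2); last first.
  + by case: (in_ideal_neq _ (-2) 0 Mt _) => //; rewrite te; lra.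
  + (* -1 0 0 y becomes 0 1 0 (y + 1) *)
    case: n IH h switch => [|n] IH h _; first by exfalso; case: h => ? _; scaled_lra t.
    have {}h : rep_len n (b * (b * t + (b + 2))) v by apply: rep_len_digit0 h _; scaled_lra t.
    case: n IH h => [|n] IH h; first by exfalso; case: h => ? _; scaled_lra t.
    have {}h : rep_len n (b * (b * (b * t + (b + 2)))) v by apply: rep_len_digit0 h _; scaled_lra t.
    have {}h : rep (b * (b * (b * t + (b + 2))) - (b + 2)) v.
      by apply: near_sub h _; [apply: IH; lia | scaled_lra t].
    apply: rep_mk1 (erefl _) _; last by scaled_lra t.
    apply: rep_mk0 (erefl _) _; last by scaled_lra t.
    apply: rep_mk0 h _ _; [eqb t | scaled_lra t].
  + have {}h : rep (b * (b * t + (b + 2))) v.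
      case: n h {IH switch} => [[-> ->]|n h]; first by exists 0%N; rewrite mulr0.
      by exists n; apply: rep_len_digit0 h _; scaled_lra t.
    apply: rep_mk0 (erefl _) _; last by scaled_lra t.
    apply: rep_mk1 h _ _; [eqb t | scaled_lra t].
- by exfalso; scaled_lra t.
- case: (switch _ _ _ _ h) => [||v -> {}h]; [done | by scaled_lra t |].
  apply: rep_mk1 (erefl _) _; last by scaled_lra t.
  apply: rep_mk0 h _ _; [eqb t | scaled_lra t].
Qed.

(** The exchange in the other direction. From here on either digit may be assumed in an overlap, at
    unchanged weight. *)
Lemma rep_digit0 t w : rep t w -> -2 < t < 2 -> rep (b * t) w.
Proof.
wlog t_ge0 : t / 0 <= t => [wl|].
  have [t0|t0] := leP 0 t; first exact: wl.
  move=> /rep_opp h tb; rewrite -[b * t]opprK -mulrN.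
  by apply: rep_opp; apply: wl => //; lra.
case=> n h tb; have Mt := rep_len_ideal _ _ _ h.
case: n h => [[-> ->]|n]; first by exists 0%N; rewrite mulr0.
case=> [[_ h]|[t2 [v -> h]]|[t2 _]]; [by exists n| |by have ? := b_bounds; lra].
(* 1 0 0 y becomes 0 1 0 (y + 1) *)
case: n h => [|n] h; first by exfalso; case: h => ? _; scaled_lra t.
have {}h : rep_len n (b * (b * t - (b + 2))) v by apply: rep_len_digit0 h _; scaled_lra t.
case: n h => [|n] h; first by exfalso; case: h => ? _; scaled_lra t.
have {}h : rep_len n (b * (b * (b * t - (b + 2)))) v by apply: rep_len_digit0 h _; scaled_lra t.
have {}h := near_addP _ _ _ h _.
apply: rep_mk1 (erefl _) _; last by scaled_lra t.
apply: rep_mk0 (h _) _ _; [scaled_lra t | eqb t | scaled_lra t].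
Qed.

Lemma rep_digit1 t w : rep t w -> b < t < 2 * b -> exists2 v, w = v.+1 & rep (b * t - (b + 2)) v.
Proof. by case=> n h tb; apply: switch_01 h tb => m _; apply: near_addP. Qed.

Lemma rep_digitN1 t w : rep t w -> - 2 * b < t < - b -> exists2 v, w = v.+1 & rep (b * t + (b + 2)) v.
Proof.
move=> /rep_opp h tb; case: (rep_digit1 _ _ h) => [|v -> /rep_opp e]; first by lra.
by exists v => //; move: e; congr (rep _ _); ring.
Qed.

Lemma rep_ideal t w : rep t w -> in_ideal t.
Proof. by case=> n /rep_len_ideal. Qed.

(** * Adding one power of [b] at cost at most one *)

Definition adds d t w := exists2 v, (v <= w.+1)%N & rep (t + d) v.

(** Used for [d = (b - 1) ^+ m * (b + 2)], the scaled b^(-m). As [d > 0], only the upper end of the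
    range can be exceeded. *)
Definition can_add d := forall t w, rep t w -> t + d < 2 * b -> adds d t w.

Lemma can_sub d t w : can_add d -> rep t w -> - 2 * b < t - d -> adds (- d) t w.
Proof.
move=> h /rep_opp /h {}h tb; case: h => [|v vw /rep_opp e]; first by lra.
by exists v => //; move: e; congr (rep _ _); ring.
Qed.

Lemma digitP t w : rep t w ->
  [\/ -2 < t < 2 /\ rep (b * t) w,
      b < t < 2 * b /\ exists2 v, w = v.+1 & rep (b * t - (b + 2)) v |
      - 2 * b < t < - b /\ exists2 v, w = v.+1 & rep (b * t + (b + 2)) v].
Proof.
case=> -[[-> ->]|n].
  apply: Or31; split; last by exists 0%N; rewrite mulr0.
  by lra.
case=> [[tb h]|[tb [v -> h]]|[tb [v -> h]]];
  [apply: Or31|apply: Or32|apply: Or33]; split=> //; try (by exists n).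
all: by exists v => //; exists n.
Qed.

(** Between the two cuts [near_addP] applies. Above them 1.00y = 0.10(y + 1), below them 1.(-1)0y =
    0.00(y + 1), and y + 1 is again free. *)
Lemma can_add_0 : can_add (b + 2).
Proof.
move=> t w h tb; have Mt := rep_ideal _ _ h.
have t1 : - 2 * b < t.
  by case: (digitP _ _ h) => -[? _]; have ? := b_bounds; lra.
have [ta|ta|te] := ltgtP t (- (b + 1)); last first.
- by case: (in_ideal_neq _ (-1) (-1) Mt _) => //; rewrite te; lra.
- have [tc|tc|te] := ltgtP t (-1).
  + by exists w => //; case: h => n h; apply: near_addP h _; lra.
  + have {}h : rep (b * (b * t)) w.
      by apply: rep_digit0; [apply: rep_digit0 h _; scaled_lra t | scaled_lra t].
    have {}h : rep (b * (b * t) + (b + 2)) w.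
      by case: h => n h; apply: near_addP h _; scaled_lra t.
    exists w.+1 => //; apply: rep_mk1 (erefl _) _; last by scaled_lra t.
    apply: rep_mk0 h _ _; [eqb t | scaled_lra t].
  + by case: (in_ideal_neq _ (-1) 0 Mt _) => //; rewrite te; lra.
- case: (rep_digitN1 _ _ h) => [|v -> {}h]; first by lra.
  have {}h : rep (b * (b * t + (b + 2))) v by apply: rep_digit0 h _; scaled_lra t.
  have {}h : rep (b * (b * t + (b + 2)) + (b + 2)) v.
    by case: h => n h; apply: near_addP h _; scaled_lra t.
  exists v; first by lia.
  apply: rep_mk0 (erefl _) _; last by scaled_lra t.
  apply: rep_mk0 h _ _; [eqb t | scaled_lra t].
Qed.

Lemma can_add_1 : can_add (2 * b - 1).
Proof.
move=> t w h tb; have Mt := rep_ideal _ _ h; have ? := bb.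
case: (digitP _ _ h) => [[t2 {}h]|[t2 _]|[t2 [v -> {}h]]].
- have [ta|ta|te] := ltgtP t (1 - b); last first.
  + by case: (in_ideal_neq _ 1 (-1) Mt _) => //; rewrite te; lra.
  + by exists w.+1 => //; apply: rep_mk1 h _ _; [eqb t | scaled_lra t].
  + case: (can_add_0 _ _ h) => [|v vw {}h]; first by scaled_lra t.
    by exists v => //; apply: rep_mk0 h _ _; [eqb t | scaled_lra t].
- by exfalso; have ? := b_bounds; lra.
- by exists v; [lia | apply: rep_mk0 h _ _; [eqb t | scaled_lra t]].
Qed.

(** The induction is on the weight because 0 2 y = 1 0 (y + b^(-2)) and -1 y + b^(-2) = 0 (y -
    b^(-2)) return to the same claim for a lighter y. *)
Lemma can_add_2 : can_add (3 - b).
Proof.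
move=> t w; elim/ltn_ind: w t => w IH t h tb; have Mt := rep_ideal _ _ h; have ? := bb.
have sub u v : (v < w)%N -> rep u v -> - 2 * b < u - (3 - b) -> adds (- (3 - b)) u v.
  move=> vw hu ub; case: (IH _ vw _ (rep_opp _ _ hu)) => [|k kv /rep_opp e]; first by lra.
  by exists k => //; move: e; congr (rep _ _); ring.
case: (digitP _ _ h) => [[t2 {}h]|[t2 [v e {}h]]|[t2 [v e {}h]]].
- have [ta|ta|te] := ltgtP t (b - 1); last first.
  + by case: (in_ideal_neq _ (-1) 1 Mt _) => //; rewrite te; lra.
  + case: (digitP _ _ h) => [[u2 {}h]|[u2 [v e {}h]]|[u2 _]]; last 1 first.
    * by exfalso; scaled_lra t.
    * (* 0 1 1 y becomes 1 0 0 y *)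
      case: (rep_digit1 _ _ h) => [|v -> {}h]; first by scaled_lra t.
      exists v.+1; first by lia.
      apply: rep_mk1 (erefl _) _; last by scaled_lra t.
      apply: rep_mk0 (erefl _) _; last by scaled_lra t.
      apply: rep_mk0 h _ _; [eqb t | scaled_lra t].
    * case: (IH v _ _ h) => [||k kv {}h]; [by lia | by scaled_lra t|].
      exists k.+1; first by lia.
      apply: rep_mk1 (erefl _) _; last by scaled_lra t.
      apply: rep_mk0 h _ _; [eqb t | scaled_lra t].
  + case: (can_add_1 _ _ h) => [|k kv {}h]; first by scaled_lra t.
    by exists k => //; apply: rep_mk0 h _ _; [eqb t | scaled_lra t].
- case: (can_add_1 _ _ h) => [|k kv {}h]; first by scaled_lra t.
  by exists k.+1; [lia | apply: rep_mk1 h _ _; [eqb t | scaled_lra t]].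
- case: (sub _ _ _ h) => [||k kv {}h]; [by lia | by scaled_lra t|].
  by exists k; [lia | apply: rep_mk0 h _ _; [eqb t | scaled_lra t]].
Qed.

Lemma can_add_3 : can_add (3 * b - 4).
Proof.
move=> t w h tb; have ? := bb.
case: (digitP _ _ h) => [[t2 {}h]|[t2 [v e {}h]]|[t2 [v e {}h]]].
- have [ta|ta] := ltP t (6 - 3 * b).
  + case: (can_add_2 _ _ h) => [|k kv {}h]; first by scaled_lra t.
    by exists k => //; apply: rep_mk0 h _ _; [eqb t | scaled_lra t].
  + have {}ta : 1 < t by have ? := b_bounds; lra.
    case: (rep_digit1 _ _ h) => [|v -> {}h]; first by scaled_lra t.
    exists v.+1; first by lia.
    apply: rep_mk1 (erefl _) _; last by scaled_lra t.
    apply: rep_mk0 h _ _; [eqb t | scaled_lra t].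
- case: (can_add_2 _ _ h) => [|k kv {}h]; first by scaled_lra t.
  by exists k.+1; [lia | apply: rep_mk1 h _ _; [eqb t | scaled_lra t]].
(* Any cut between [2 - 3 * b] and [4 - 4 * b] works: below it the sum stays under [- b] and keeps
   the digit -1, above it the sum exceeds -2 and -1 y + b^(-3) = 0 (y - b^(-1)). *)
- have [ta|ta] := ltP t (- 13 / 5).
  + case: (can_add_2 _ _ h) => [|k kv {}h]; first by scaled_lra t.
    by exists k.+1; [lia | apply: rep_mkN1 h _ _; [eqb t | scaled_lra t]].
  + have {}ta : - 14 / 5 < t by lra.
    case: (can_sub _ _ _ can_add_1 h) => [|k kv {}h]; first by scaled_lra t.
    by exists k; [lia | apply: rep_mk0 h _ _; [eqb t | scaled_lra t]].
Qed.

Lemma can_add_4 : can_add (7 - 4 * b).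
Proof.
move=> t w h tb; have ? := bb.
case: (digitP _ _ h) => [[t2 {}h]|[t2 [v e {}h]]|[t2 [v e {}h]]].
- have [ta|ta] := ltP t (4 * b - 5).
  + case: (can_add_3 _ _ h) => [|k kv {}h]; first by scaled_lra t.
    by exists k => //; apply: rep_mk0 h _ _; [eqb t | scaled_lra t].
  + have {}ta : 13 / 10 < t by have ? := b_bounds; lra.
    case: (rep_digit1 _ _ h) => [|v -> {}h]; first by scaled_lra t.
    (* The identity is 0 1 y + b^(-4) = 1 0 (y - b^(-3)). *)
    case: (can_sub _ _ _ can_add_3 h) => [|k kv {}h]; first by scaled_lra t.
    exists k.+1; first by lia.
    apply: rep_mk1 (erefl _) _; last by scaled_lra t.
    apply: rep_mk0 h _ _; [eqb t | scaled_lra t].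
- case: (can_add_3 _ _ h) => [|k kv {}h]; first by scaled_lra t.
  by exists k.+1; [lia | apply: rep_mk1 h _ _; [eqb t | scaled_lra t]].
- have [ta|ta] := ltP t (3 * b - 7).
  + case: (can_add_3 _ _ h) => [|k kv {}h]; first by scaled_lra t.
    by exists k.+1; [lia | apply: rep_mkN1 h _ _; [eqb t | scaled_lra t]].
  + have {}ta : -11 / 5 < t by have ? := b_bounds; lra.
    (* -1 0 y becomes 0 -1 (y - (3b - 4)) *)
    have {}h : rep (b * (b * t + (b + 2))) v by apply: rep_digit0 h _; scaled_lra t.
    case: (can_sub _ _ _ can_add_3 h) => [|k kv {}h]; first by scaled_lra t.
    exists k.+1; first by lia.
    apply: rep_mk0 (erefl _) _; last by scaled_lra t.
    apply: rep_mkN1 h _ _; [eqb t | scaled_lra t].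
Qed.

(** Induction on the length of the first word: the exchange lemmas let the second word take the same
    leading digit. *)
Lemma rep_uniq t w w' : rep t w -> rep t w' -> w = w'.
Proof.
case=> n; elim: n t w w' => [|n IH] t w w'.
  case=> -> -> [n]; elim: n w' => [|n IH] w' /=; first by case.
  by rewrite mulr0 => -[[_ /IH]//||] [h _]; exfalso; have ? := b_bounds; lra.
case=> [[tb h] h'|[tb [v -> h]] h'|[tb [v -> h]] h'].
- by apply: IH h _; apply: rep_digit0 h' _.
- by case: (rep_digit1 _ _ h' tb) => v' -> /(IH _ _ _ h) ->.
- by case: (rep_digitN1 _ _ h' tb) => v' -> /(IH _ _ _ h) ->.
Qed.

(** The overlap (b, 2) has width [2 - b > 3 / 8 > d], so [t] and [t + d] share a digit range.
    Keeping that digit leaves the problem for [b * d] one place further. *)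
Lemma can_add_small d : 0 < d -> b * d <= 7 - 4 * b -> can_add (b * d) -> can_add d.
Proof.
move=> d0 bd add t w h tb; have ? := bb; have ? := b_bounds.
have d1 : d < 3 / 8.
  have : 8 / 5 * d < b * d by rewrite ltr_pM2r //; lra.
  by move=> ?; lra.
have bM (u v : R) : u < v -> b * u < b * v by apply: scale_lt.
have main1 : b < t < 2 * b -> adds d t w.
  move=> t2; case: (rep_digit1 _ _ h t2) => v -> {}h.
  case: (add _ _ h) => [|k kv {}h]; first by have ? := bM _ _ tb; lra.
  have ? := bM t (2 * b); exists k.+1 => //.
  by apply: rep_mk1 h _ _; [ring | lra].
have main0 : -2 < t -> t + d < 2 -> adds d t w.
  move=> t2 td; have {}h : rep (b * t) w by apply: rep_digit0 h _; lra.
  case: (add _ _ h) => [|k kv {}h]; first by have ? := bM _ _ td; lra.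
  by exists k => //; apply: rep_mk0 h _ _; [ring | lra].
case: (digitP _ _ h) => [[t2 _]|[t2 _]|[t2 [v e {}h]]]; last 1 first.
- have [ta|ta] := ltP (t + d) (- b); last by apply: main0; lra.
  case: (add _ _ h) => [|k kv {}h]; first by have ? := bM _ _ ta; lra.
  exists k.+1; first by rewrite e.
  by apply: rep_mkN1 h _ _; [ring | lra].
- by have [ta|ta] := ltP (t + d) 2; [apply: main0; lra | apply: main1; lra].
- by apply: main1.
Qed.

(** * All powers of [b - 1], the inverse of [b], and integer multiples *)

Lemma b1M t : (b - 1) * (b * t) = t.
Proof. by rewrite mulrBl bbM; ring. Qed.

Lemma bM1 t : b * ((b - 1) * t) = t.
Proof. by rewrite mulrCA b1M. Qed.

Lemma b1sq : (b - 1) ^+ 2 = 2 - b.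
Proof. by have ? := bb; rewrite expr2; lra. Qed.

Lemma b1_pow_itv m : 0 < (b - 1) ^+ m <= 1.
Proof.
have ? := b_bounds; rewrite exprn_gt0 ?exprn_ile1 //; lra.
Qed.

Lemma can_add_pow m : can_add ((b - 1) ^+ m * (b + 2)).
Proof.
have ? := b_bounds; have ? := bb.
case: m => [|[|[|[|m]]]].
- by rewrite expr0 mul1r; apply: can_add_0.
- have -> : (b - 1) ^+ 1 * (b + 2) = 2 * b - 1 by rewrite expr1; lra.
  exact: can_add_1.
- have -> : (b - 1) ^+ 2 * (b + 2) = 3 - b by rewrite b1sq; lra.
  exact: can_add_2.
- have -> : (b - 1) ^+ 3 * (b + 2) = 3 * b - 4 by rewrite exprS b1sq; have ? := b3; lra.
  exact: can_add_3.
- have e4 : (b - 1) ^+ 4 * (b + 2) = 7 - 4 * b.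
    by rewrite -[4%N]/((2 * 2)%N) exprM b1sq expr2; have ? := b3; lra.
  elim: m => [|m IH]; first by rewrite e4; apply: can_add_4.
  apply: can_add_small.
  + by have := b1_pow_itv m.+1.+4 => /andP[? _]; apply: mulr_gt0 => //; lra.
  + rewrite exprS -mulrA bM1 -e4 -addn4 exprD -mulrA ler_piMl //; last first.
      by case/andP: (b1_pow_itv m).
    by rewrite e4; lra.
  + by rewrite exprS -mulrA bM1.
Qed.

Lemma rep_bounds t w : rep t w -> - 2 * b < t < 2 * b.
Proof. by move=> /digitP[][? _]; have ? := b_bounds; lra. Qed.

(** Prepending zeros: dividing the bound [2 * b] by [b] gives 2, so the digit 0 is legal. *)
Lemma rep_shift t w m : rep t w -> rep ((b - 1) ^+ m * t) w.
Proof.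
elim: m => [|m IH] h; first by rewrite expr0 mul1r.
have {}h := IH h; have /andP[h1 h2] := rep_bounds _ _ h.
apply: rep_mk0 h _ _; first by rewrite exprS -mulrA bM1.
move: h1 h2; rewrite exprS -mulrA; set u := _ ^+ m * t.
have ? := bb; have b1 : 0 < b - 1 by have ? := b_bounds; lra.
by rewrite -(ltr_pM2l b1) -(ltr_pM2l b1 u) => h1 h2; lra.
Qed.

(** Two leading zeros make room for any unit: [(b - 1) ^+ 2 * (2 * b + (b + 2)) = b + 1 < 2 * b]. *)
Lemma rep_add t w m : rep t w ->
  exists2 v, (v <= w.+1)%N & rep ((b - 1) ^+ 2 * (t + (b - 1) ^+ m * (b + 2))) v.
Proof.
move=> h; have /andP[_ tb] := rep_bounds _ _ h; have ? := bb; have ? := b_bounds.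
case: (can_add_pow (m + 2) _ _ (rep_shift _ _ 2 h)) => [|v vw e].
  have b2 : 0 < (b - 1) ^+ 2 by rewrite b1sq; lra.
  have h1 : (b - 1) ^+ 2 * t < (b - 1) ^+ 2 * (2 * b) by rewrite ltr_pM2l.
  have h2 : (b - 1) ^+ (m + 2) * (b + 2) <= (b - 1) ^+ 2 * (b + 2).
    rewrite exprD -mulrA ler_piMl //; last by case/andP: (b1_pow_itv m).
    by apply: mulr_ge0; lra.
  by move: h1 h2; rewrite b1sq => h1 h2; lra.
exists v => //; move: e; congr (rep _ _); rewrite exprD; ring.
Qed.

Lemma rep_addn t w m n : rep t w ->
  exists k, exists2 v, (v <= w + n)%N &
    rep ((b - 1) ^+ k * (t + n%:R * ((b - 1) ^+ m * (b + 2)))) v.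
Proof.
move=> h; elim: n => [|n [k [v vw {}h]]].
  by exists 0%N, w; rewrite ?addn0 // expr0 mul1r mul0r addr0.
(* The sum so far is scaled by [(b - 1) ^+ k], hence the next unit sits [k] places further right. *)
case: (rep_add _ _ (k + m) h) => v' vv' {}h.
exists (k + 2)%N, v'; first by lia.
by move: h; congr (rep _ _); rewrite !exprD -natr1; ring.
Qed.

Lemma rep_addz t w m (c : int) : rep t w ->
  exists k, exists2 v, (v <= w + absz c)%N &
    rep ((b - 1) ^+ k * (t + c%:~R * ((b - 1) ^+ m * (b + 2)))) v.
Proof.
case: (intP c) => [|n|n] h.
- by case: (rep_addn _ _ m 0 h) => k [v vw e]; exists k, v.
- by case: (rep_addn _ _ m n.+1 h) => k [v vw e]; exists k, v.
- case: (rep_addn _ _ m n.+1 (rep_opp _ _ h)) => k [v vw /rep_opp e].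
  exists k, v; first by rewrite abszN.
  by move: e; congr (rep _ _); rewrite rmorphN /=; ring.
Qed.

(** * Integer words compared with good words *)

(** This is [b + 2] times the usual .x, with [b - 1] in the role of 1/b. *)
Fixpoint value (x : seq int) : R :=
  if x is a :: y then (b - 1) * (a%:~R * (b + 2) + value y) else 0.

Definition wt (x : seq int) := sumn [seq absz a | a <- x].

(** The five cases regrouped by digit; an overlap of two ranges is where both digits are allowed. *)
Definition digit_ok (a : int) (t : R) :=
  [\/ a = 0 /\ -2 < t < 2, a = 1 /\ b < t < 2 * b | a = -1 /\ - 2 * b < t < - b].

Fixpoint good (x : seq int) : Prop :=
  if x is a :: y then digit_ok a (value x) /\ good y else True.

(* Minimality tested against the words described by rep only. *)
Definition minimal x := forall k v, rep ((b - 1) ^+ k * value x) v -> (wt x <= v)%N.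

Lemma value_opp x : value (map -%R x) = - value x.
Proof. by elim: x => [|a x IH] /=; rewrite ?oppr0 // IH rmorphN /=; ring. Qed.

Lemma wt_opp x : wt (map -%R x) = wt x.
Proof. by elim: x => //= a x; rewrite /wt /= abszN => ->. Qed.

Lemma value_rcons x c :
  value (rcons x c) = value x + c%:~R * ((b - 1) ^+ (size x).+1 * (b + 2)).
Proof.
elim: x => [|a x IH] /=; first by rewrite expr1; ring.
by rewrite IH [in RHS]exprS; ring.
Qed.

Lemma wt_rcons x c : wt (rcons x c) = (wt x + absz c)%N.
Proof. by rewrite /wt map_rcons sumn_rcons. Qed.

Lemma value_ideal x : in_ideal (value x).
Proof.
elim: x => [|a y IH] /=; first by exists 0, 0; rewrite mul0r addr0 mul0r.
case: IH => p [q ->]; exists (q - p - a), (p + a).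
have ? := bb; rewrite !rmorphD !rmorphN /=.
set u := p%:~R; set v := q%:~R; set c := a%:~R.
have -> : (b - 1) * (c * (b + 2) + (u + v * b) * (b + 2)) =
  ((c + u) * b - c - u + v * (b * b) - v * b) * (b + 2) by ring.
by rewrite bb; ring.
Qed.

Lemma good_rep x : good x -> rep (value x) (wt x).
Proof.
have vE a y : b * value (a :: y) - a%:~R * (b + 2) = value y by rewrite /= bM1; ring.
elim: x => [|a y IH]; first by exists 0%N.
case=> da /IH {}IH; have := vE a y; move: da; set t := value _ => da {}vE.
case: da vE => -[-> tb]; rewrite /wt /= => vE.
- by apply: rep_mk0 IH _ tb; rewrite -vE; ring.
- by apply: rep_mk1 IH _ tb; rewrite -vE; ring.
- by apply: rep_mkN1 IH _ tb; rewrite -vE; ring.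
Qed.

Lemma rep_word t w : rep t w -> exists x, value x = t /\ wt x = w.
Proof.
case=> n; elim: n t w => [|n IH] t w; first by case=> -> ->; exists [::].
case=> [[_ /IH]|[_ [v -> /IH]]|[_ [v -> /IH]]] [x [e <-]].
- by exists (0 :: x); split=> //=; rewrite e -[RHS]b1M; ring.
- by exists (1 :: x); split=> //=; rewrite e -[RHS]b1M; ring.
- by exists (-1 :: x); split=> //=; rewrite e -[RHS]b1M; ring.
Qed.

(** Letters are appended on the right, a letter [c] amounting to [absz c] unit additions or
    subtractions. *)
Lemma word_rep x : exists k, exists2 v, (v <= wt x)%N & rep ((b - 1) ^+ k * value x) v.
Proof.
elim/last_ind: x => [|x c [k [v vx h]]].
  by exists 0%N, 0%N => //; rewrite mulr0; exists 0%N.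
case: (rep_addz _ _ (k + (size x).+1) c h) => j [u uv {}h].
exists (j + k)%N, u.
  by rewrite wt_rcons; apply: leq_trans uv _; rewrite leq_add2r.
by move: h; rewrite value_rcons; congr (rep _ _); rewrite !exprD; ring.
Qed.

Lemma minimal_opp x : minimal x -> minimal (map -%R x).
Proof.
move=> h k v; rewrite value_opp wt_opp mulrN => /rep_opp.
by rewrite opprK => /h.
Qed.

(** A lighter good word for a shift of [y] would give one for [a :: y], since putting [a] back costs
    at most [absz a]. *)
Lemma minimal_behead a y : minimal (a :: y) -> minimal y.
Proof.
move=> h k v e; case: (rep_addz _ _ k a e) => j [u uv].
have -> : (b - 1) ^+ j * ((b - 1) ^+ k * value y + a%:~R * ((b - 1) ^+ k * (b + 2)))
  = (b - 1) ^+ (j + k) * (b * value (a :: y)) by rewrite /= bM1 exprD; ring.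
move=> /(rep_shift _ _ 1); rewrite expr1.
have -> : (b - 1) * ((b - 1) ^+ (j + k) * (b * value (a :: y))) =
  (b - 1) ^+ (j + k) * ((b - 1) * (b * value (a :: y))) by ring.
by rewrite b1M => /h; rewrite /wt /=; lia.
Qed.

Lemma good_minimal x : good x -> minimal x.
Proof.
by move=> /good_rep h k v hv; rewrite (rep_uniq _ _ _ hv (rep_shift _ _ k h)).
Qed.

Lemma not_minimal x u v m k : (v.+1 < wt x)%N -> rep u v ->
  value x = (b - 1) ^+ k * u + (b - 1) ^+ m * (b + 2) -> ~ minimal x.
Proof.
move=> vx h e mx; case: (rep_addz _ _ m 1 (rep_shift _ _ k h)) => j [u' uv].
by rewrite mul1r -e => /mx; move: uv vx; rewrite absz1; lia.
Qed.

(** The digit 1 is legal exactly when [value y] lies in (-1, b). Outside, [y] can be made to start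
    with 1, -1 or 0 -1 by the exchange lemmas, and a rewriting saves weight. *)
Lemma minimal_1 y : good y -> minimal (1 :: y) -> digit_ok 1 (value (1 :: y)).
Proof.
move=> gy mx; have h := good_rep _ gy; have My := value_ideal y; have tb := rep_bounds _ _ h.
have vE : value (1 :: y) = (b - 1) * (b + 2 + value y) by rewrite /= mul1r.
have wE : wt (1 :: y) = (wt y).+1 by [].
have b3' : (b - 1) ^+ 3 = 2 * b - 3 by rewrite exprS b1sq; have ? := bb; lra.
move: h tb vE wE; set t := value y => h tb vE wE.
have [ta|ta|te] := ltgtP t (-1); last first.
- by case: (in_ideal_neq _ (-1) 0 My _) => //; rewrite -/t te; lra.
- have [tc|tc|te] := ltgtP t b; last first.
  + by case: (in_ideal_neq _ 0 1 My _) => //; rewrite -/t te; lra.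
  + (* 1 1 becomes 1 0 0 *)
    case: (rep_digit1 _ _ h) => [|v e {}h]; first by lra.
    case: (@not_minimal (1 :: y) _ _ 0 2 _ h) => //; first by rewrite wE e.
    by rewrite vE b1sq expr0 mul1r; eqb t.
  + apply: Or32; split=> //; rewrite vE.
    have ? := bb; have b1 : 0 < b - 1 by have ? := b_bounds; lra.
    by move: ta tc; rewrite -(ltr_pM2l b1) -(ltr_pM2l b1 t) => h1 h2; lra.
- have [tc|tc|te] := ltgtP t (- b); last first.
  + by case: (in_ideal_neq _ 0 (-1) My _) => //; rewrite -/t te; lra.
  + (* 1 0 -1 becomes 0 1 0 *)
    have {}h : rep (b * t) (wt y) by apply: rep_digit0 h _; scaled_lra t.
    case: (rep_digitN1 _ _ h) => [|v e {}h]; first by scaled_lra t.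
    case: (@not_minimal (1 :: y) _ _ 2 3 _ h) => //; first by rewrite wE e.
    by rewrite vE b1sq b3'; eqb t.
  + (* 1 -1 becomes 0 0 1 *)
    case: (rep_digitN1 _ _ h) => [|v e {}h]; first by lra.
    case: (@not_minimal (1 :: y) _ _ 3 2 _ h) => //; first by rewrite wE e.
    by rewrite vE b1sq b3'; eqb t.
Qed.

Lemma good_opp x : good x -> good (map -%R x).
Proof.
elim: x => //= a x IH [da /IH gx]; split=> //.
have := value_opp (a :: x); rewrite /= => ->.
case: da => -[-> tb]; [apply: Or31|apply: Or33|apply: Or32];
  by split; rewrite ?oppr0 ?opprK //; lra.
Qed.

Lemma minimal_good x : {subset x <= [:: -1; 0; 1]} -> minimal x -> good x.
Proof.
elim: x => // a y IH sub mx.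
have gy : good y.
  apply: IH (minimal_behead _ _ mx) => c cy; apply: sub; by rewrite inE cy orbT.
split=> //; have := sub a (mem_head _ _); rewrite !inE => /or3P[] /eqP ae.
- move: mx; rewrite ae => /minimal_opp /= mx.
  have [[]//|[_ tb]|[]//] := minimal_1 _ (good_opp _ gy) mx.
  apply: Or33; split=> //; move: tb; rewrite /= value_opp rmorphN /= => tb.
  by lra.
- apply: Or31; split=> //; rewrite ae /= mul0r add0r.
  have /andP[h1 h2] := rep_bounds _ _ (good_rep _ gy); move: h1 h2; set u := value y.
  have ? := bb; have b1 : 0 < b - 1 by have ? := b_bounds; lra.
  by rewrite -(ltr_pM2l b1) -(ltr_pM2l b1 u) => h1 h2; lra.
- by rewrite ae; apply: minimal_1; rewrite -?ae.
Qed.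

End Golden.

(** * Transfer to word values, weights and remainders of the statement *)

Lemma golden_ratio_gt0 (R : realType) : 0 < golden_ratio R.
Proof.
rewrite /golden_ratio; have : 0 <= Num.sqrt 5 :> R by apply: sqrtr_ge0.
by move=> ?; lra.
Qed.

Lemma golden_ratio_sq (R : realType) :
  golden_ratio R * golden_ratio R = golden_ratio R + 1.
Proof.
rewrite /golden_ratio; have : Num.sqrt 5 ^+ 2 = 5 :> R by rewrite sqr_sqrtr.
by rewrite expr2; set s := Num.sqrt 5 => ?; lra.
Qed.

Section Words.
Variables (R : realType) (b : R).
Hypotheses (b_gt0 : 0 < b) (bb : b * b = b + 1).

Lemma b_neq0 : b != 0.
Proof. by rewrite gt_eqF. Qed.

Lemma invb : b^-1 = b - 1.
Proof. by apply: (mulfI b_neq0); rewrite mulfV ?b_neq0 // mulrBr bb; ring. Qed.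

Lemma word_value_cons a x : word_value b (a :: x) = (b - 1) * (a%:~R + word_value b x).
Proof.
rewrite /word_value /= big_nat_recl // mulrDr; congr (_ + _).
  by rewrite expr1 invb mulrC.
rewrite big_distrr /=; apply: eq_big_nat => -[|i] // _.
by rewrite /letter /= exprS invfM invb; ring.
Qed.

Lemma value_word_value x : value R b x = (b + 2) * word_value b x.
Proof.
elim: x => [|a x IH]; first by rewrite /word_value big_geq // mulr0.
by rewrite word_value_cons /= IH; ring.
Qed.

Lemma weight_wt x : weight x = wt x.
Proof.
by rewrite /weight /wt sumnE big_map big_add1 /= [RHS](big_nth 0).
Qed.

Lemma b1_pow k : (b - 1) ^+ k = b ^ (- k%:Z).
Proof. by rewrite -invb exprVn exprnN. Qed.

(** Good words suffice as competitors: [word_rep] replaces any integer word by a good one that is no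
    heavier. *)
Lemma minimal_weightP x : minimal_weight b x <-> minimal R b x.
Proof.
have b2 : b + 2 != 0 by rewrite gt_eqF //; have ? := b_gt0; lra.
split=> [mx k v h|mx [y [[k e] lt_yx]]].
- rewrite leqNgt; apply/negP => lt_v; apply: mx.
  case: (rep_word _ _ b_gt0 bb _ _ h) => y [ey wy]; exists y.
  split; last by rewrite !weight_wt wy.
  exists k%:Z; apply: (mulfI b2); rewrite mulrCA -!value_word_value ey.
  by rewrite b1_pow mulrA -(expfzDr _ _ b_neq0) subrr expr0z mul1r.
(* The exponent [k] may be negative; [|k|] extra zeros make [|k| + j + k] a natural shift. *)
- case: (word_rep _ _ b_gt0 bb y) => j [v vy /(rep_shift _ _ b_gt0 bb _ _ `|k|%N) h].
  suff /mx : rep R b ((b - 1) ^+ absz ((`|k|%N%:Z + j%:Z + k)%R) * value R b x) v.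
    by move: lt_yx; rewrite !weight_wt; lia.
  move: h; congr (rep _ _ _ _).
  rewrite !value_word_value e !b1_pow (_ : Posz `|_ + k| = (`|k|%N%:Z + j%:Z + k)%R); last by lia.
  rewrite !opprD !(expfzDr _ _ b_neq0) -[X in _ = X]mulrA [X in _ = X]mulrCA.
  have ek : b ^ (- k) * b ^ k = 1 by rewrite -(expfzDr _ _ b_neq0) addNr expr0z.
  set p := b ^ _; set q := b ^ _; set r := word_value b y.
  transitivity (p * q * ((b + 2) * r) * (b ^ (- k) * b ^ k)); first by rewrite ek; ring.
  by ring.
Qed.

(** Both sides obey the recursion t_(j+1) = b t_j - x_j; hence t_j is the value of the suffix
    starting at x_j. *)
Lemma remainder_drop x j : (j <= size x)%N ->
  remainder b x (word_value b x) j.+1 = word_value b (drop j x).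
Proof.
rewrite /remainder; elim: j => [|j IH] jx.
  by rewrite subnn expr0 mul1r big_geq // subr0 drop0.
have := IH (ltnW jx); rewrite (drop_nth 0 jx) word_value_cons => /(congr1 ( *%R b)).
rewrite (bM1 _ _ b_gt0 bb) !subn1 /= => e; apply: (addrI ((x`_j)%:~R)); rewrite -e.
rewrite big_nat_recr //= subnn expr0 mulr1 exprS mulrBr.
rewrite (eq_big_nat _ _ (F2 := fun i => b * ((letter x i)%:~R * b ^+ (j - i)))).
  by rewrite -big_distrr /= [letter x j.+1]/=; ring.
by move=> i /andP[_ ij]; rewrite subSn // exprS; ring.
Qed.

Lemma good_nth x : good R b x <->
  forall j, (j < size x)%N -> digit_ok R b x`_j (value R b (drop j x)).
Proof.
elim: x => [|a x IH]; first by split.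
split=> [[da /IH h] [|j] //= jx|h]; first exact: h.
split; first exact: (h 0%N).
by apply/IH => j jx; apply: (h j.+1).
Qed.

Lemma digit_okP x a t : value R b x = (b + 2) * t ->
  digit_ok R b a (value R b x) <->
  (2 / (b ^+ 2 + 1) < t < 2 * b / (b ^+ 2 + 1) /\ a = 1)
  \/ (b / (b ^+ 2 + 1) < t < 2 / (b ^+ 2 + 1) /\ a \in [:: 0; 1])
  \/ (- b / (b ^+ 2 + 1) < t < b / (b ^+ 2 + 1) /\ a = 0)
  \/ (- 2 / (b ^+ 2 + 1) < t < - b / (b ^+ 2 + 1) /\ a \in [:: -1; 0])
  \/ (- 2 * b / (b ^+ 2 + 1) < t < - 2 / (b ^+ 2 + 1) /\ a = -1).
Proof.
have b2 : 0 < b + 2 by have ? := b_gt0; lra.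
have -> : b ^+ 2 + 1 = b + 2 by rewrite expr2 bb; ring.
have Mv := value_ideal R b b_gt0 bb x.
have neq c d := in_ideal_neq R b b_gt0 bb _ c d Mv; move: (value R b x) neq => T neq Te.
have {Te} -> : t = T / (b + 2) by rewrite Te mulrC mulKf // gt_eqF.
rewrite !ltr_pM2r ?invr_gt0 // !inE.
have neq' c d : ~~ (5 %| 2 * c + d)%Z -> T < c%:~R + d%:~R * b \/ c%:~R + d%:~R * b < T.
  by move=> /neq /eqP; rewrite neq_lt => /orP.
(* For the thresholds 2, -2, b, -b the number [2 * c + d] is 4, -4, 1, -1, never divisible by 5.
   This closes the gaps between the strict inequalities. *)
have n1 := neq' 2 0 isT; have n2 := neq' (-2) 0 isT.
have n3 := neq' 0 1 isT; have n4 := neq' 0 (-1) isT.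
have ? := b_bounds R b b_gt0 bb; rewrite /digit_ok.
split.
- case=> -[-> tb].
  + case: n3 => n3; first case: n4 => n4.
    * by do 3 right; left; split; [lra | ].
    * by do 2 right; left; split; [lra | ].
    * by right; left; split; [lra | ].
  + case: n1 => n1; last by left; split; [lra | ].
    by right; left; split; [lra | ].
  + case: n2 => n2; first by do 4 right; split; [lra | ].
    by do 3 right; left; split; [lra | ].
- case=> [[tb ->]|[[tb /orP[]/eqP->]|[[tb ->]|[[tb /orP[]/eqP->]|[tb ->]]]]].
  + by apply: Or32; split=> //; lra.
  + by apply: Or31; split=> //; lra.
  + by apply: Or32; split=> //; lra.
  + by apply: Or31; split=> //; lra.
  + by apply: Or33; split=> //; lra.
  + by apply: Or31; split=> //; lra.
  + by apply: Or33; split=> //; lra.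
Qed.

End Words.

Theorem mainTheorem9 (R : realType) (beta : R) (hbeta : beta = golden_ratio R)
    (n : nat) (x : seq int) (hn : size x = n)
    (hx : forall a : int, a \in x -> a \in [:: -1; 0; 1])
    (z : R) (hz : z = \sum_(1 <= j < n.+1) (letter x j)%:~R * beta ^- j)
    (t : nat -> R)
    (ht : forall j : nat, (1 <= j <= n)%N -> t j = remainder beta x z j) :
  minimal_weight beta x <->
  (- (2 * beta / (beta ^+ 2 + 1)) < z < 2 * beta / (beta ^+ 2 + 1) /\
   forall j : nat, (1 <= j <= n)%N ->
     (2 / (beta ^+ 2 + 1) < t j < 2 * beta / (beta ^+ 2 + 1)
        /\ letter x j = 1)
  \/ (beta / (beta ^+ 2 + 1) < t j < 2 / (beta ^+ 2 + 1)
        /\ letter x j \in [:: 0; 1])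
  \/ (- beta / (beta ^+ 2 + 1) < t j < beta / (beta ^+ 2 + 1)
        /\ letter x j = 0)
  \/ (- 2 / (beta ^+ 2 + 1) < t j < - beta / (beta ^+ 2 + 1)
        /\ letter x j \in [:: -1; 0])
  \/ (- 2 * beta / (beta ^+ 2 + 1) < t j < - 2 / (beta ^+ 2 + 1)
        /\ letter x j = -1)).
Proof.
have b_gt0 : 0 < beta by rewrite hbeta golden_ratio_gt0.
have bb : beta * beta = beta + 1 by rewrite hbeta golden_ratio_sq.
have zE : z = word_value beta x by rewrite hz /word_value hn.
have digitE j : (j < size x)%N ->
    value R beta (drop j x) = (beta + 2) * t j.+1.
  move=> jx; rewrite ht -?hn // zE remainder_drop ?value_word_value //; exact: ltnW.
have goodE : minimal_weight beta x <-> good R beta x.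
  apply: iff_trans (minimal_weightP _ _ b_gt0 bb _) _.
  by split; [apply: minimal_good | apply: good_minimal].
apply: iff_trans goodE _; split=> [gx|[_ h]]; last first.
  apply/(good_nth _ _ b_gt0 bb) => j jx; apply/(digit_okP _ _ b_gt0 bb _ _ _ (digitE _ jx)).
  by apply: (h j.+1); rewrite -hn.
split.
  (* The bounds on [z] are those of any good word, the empty one included, divided by [beta + 2]. *)
  have := rep_bounds _ _ b_gt0 bb _ _ (good_rep _ _ b_gt0 bb _ gx).
  rewrite value_word_value // -zE.
  have b2 : 0 < beta + 2 by lra.
  have -> : beta ^+ 2 + 1 = beta + 2 by rewrite expr2 bb; ring.
  rewrite -mulNr ltr_pdivrMr // ltr_pdivlMr // [z * _]mulrC; lra.
move=> [|j] // /andP[_]; rewrite -hn => jx.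
by apply/(digit_okP _ _ b_gt0 bb _ _ _ (digitE _ jx)); apply: (iffLR (good_nth _ _ b_gt0 bb _) gx).
Qed.
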